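(* Let $m_2^+ < p^-$. Assume that there exist functions $m_1,m_2:S\to[2,+\infty)$ and $\varphi_1,\varphi_2,\psi_1,\psi_2:S\to(0,+\infty)$ such that $$\psi_1(x)+\varphi_1(x)t^{m_1(x)-1}\le f(x,t)\le \varphi_2(x)t^{m_2(x)-1}+\psi_2(x)\quad\text{for all }x\in S,\ t\ge 0,$$ where $m_2^+=\max_{x\in S}m_2(x)$ and $p^-=\min_{x\in S}p(x)$. Then for every $\lambda>0$ the problem $$\begin{cases}-\Delta_{p(x),\omega}u(x)+q(x)|u(x)|^{p(x)-2}u(x)=\lambda f(x,u(x)), & x\in S,\\ u(x)=0, & x\in\partial S,\end{cases}$$ has at least one positive solution.
   Context: Let $\overline S=(S\cup\partial S,V)$ be a simple, connected, undirected, weighted graph whose vertex set is the union of two finite, disjoint, nonempty sets $S$ (interior) and $\partial S$ (boundary), and whose edge set is $V$, a set of unordered pairs of distinct vertices. The symbol $\overline S$ also denotes the vertex set $S\cup\partial S$. The weight is a function $\omega:\overline S\times\overline S\to[0,+\infty)$ with $\omega(x,y)=\omega(y,x)$ if $\{x,y\}\in V$, and $\omega(x,y)=0$ if and only if $\{x,y\}\notin V$. The functions $q:S\to(0,+\infty)$ and $p:\overline S\to[2,+\infty)$ are given, and $f:S\times\mathbb R\to\mathbb R$ is such that $f(x,\cdot)$ is continuous for each $x\in S$. The discrete $p(\cdot)$-Laplacian of $u:\overline S\to\mathbb R$ is $$\Delta_{p(x),\omega}u(x)=\sum_{y\in\overline S}|u(y)-u(x)|^{p(x)-2}(u(y)-u(x))\,\omega(x,y),\quad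 x\in\overline S.$$ A positive solution is a function $u:\overline S\to\mathbb R$ satisfying the equation on $S$, the boundary condition $u=0$ on $\partial S$, and $u(x)>0$ for all $x\in S$. *)

(* Defs.v *)
From HB Require Import structures.
From mathcomp Require Import all_boot all_order all_algebra.
From mathcomp Require Import all_classical all_reals all_analysis.

Set Implicit Arguments.
Unset Strict Implicit.
Unset Printing Implicit Defensive.

Import Order.TTheory GRing.Theory Num.Theory.
Import numFieldNormedType.Exports.

Local Open Scope ring_scope.

(* The finite type T is the whole vertex set. A function that the mathematics
   defines only on S is a total function on T, and every definition and
   hypothesis looks only at its values at points of S. *)

Section WeightedGraph.
Variables (R : realType) (T : finType).

Definition adjacent (V : {set {set T}}) : rel T :=
  fun x y => [set x; y]%SET \in V.

(* There are no loops: [set x; x] has one element. *)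
Record weighted_graph_with_boundary
    (S dS : {set T}) (V : {set {set T}}) (w : T -> T -> R) : Prop := {
  vertices_cover : S :|: dS = [set: T]%SET;
  interior_boundary_disjoint : [disjoint S & dS];
  interior_nonempty : S != finset.set0;
  boundary_nonempty : dS != finset.set0;
  edges_are_pairs : forall e : {set T}, e \in V -> #|e| = 2%N;
  graph_connected : forall x y : T, connect (adjacent V) x y;
  weight_ge0 : forall x y : T, 0 <= w x y;
  weight_sym : forall x y : T, adjacent V x y -> w x y = w y x;
  weight_eq0 : forall x y : T, w x y = 0 <-> ~~ adjacent V x y
}.

(* The value 0 on the empty set is a dummy. *)
Definition max_on (S : {set T}) (F : T -> R) : R :=
  if [pick x in S] is Some x0 then F [arg max_(x > x0 in S) F x]%O else 0.

Definition min_on (S : {set T}) (F : T -> R) : R :=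
  if [pick x in S] is Some x0 then F [arg min_(x < x0 in S) F x]%O else 0.

(* 0 `^ 0 = 1, so for p x = 2 a term with u y = u x is 1 * 0 * w x y = 0. *)
Definition p_laplacian (w : T -> T -> R) (p u : T -> R) (x : T) : R :=
  \sum_(y : T) `|u y - u x| `^ (p x - 2) * (u y - u x) * w x y.

Definition dirichlet_solution (S dS : {set T}) (w : T -> T -> R)
    (p q : T -> R) (g : T -> R -> R) (u : T -> R) : Prop :=
  (forall x, x \in S ->
     - p_laplacian w p u x + q x * `|u x| `^ (p x - 2) * u x = g x (u x)) /\
  (forall x, x \in dS -> u x = 0).

Definition positive_solution (S dS : {set T}) (w : T -> T -> R)
    (p q : T -> R) (g : T -> R -> R) (u : T -> R) : Prop :=
  dirichlet_solution S dS w p q g u /\ (forall x, x \in S -> 0 < u x).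

End WeightedGraph.

(* Main.v *)
(* The exponent p depends on the vertex, so the equation has no variational
   structure. The proof uses instead that the residual
     F u x = - Delta_p u x + q x |u x|^(p x - 2) u x - lambda f x (u x)
   is nonincreasing in the values of u at the vertices other than x. Hence the
   pointwise infimum of all supersolutions lying between a subsolution and a
   supersolution is a supersolution again, and where its residual were positive
   it could be lowered a little; so it is a solution.
   The subsolution is 0 and, since m2 < p, the supersolution is a large constant
   on S extended by 0. A solution u >= 0 vanishing at some x in S would
   have F u x <= F 0 x = - lambda f x 0 < 0. *)

Require Import Defs.
From HB Require Import structures.
From mathcomp Require Import all_boot all_order all_algebra.
From mathcomp Require Import all_classical all_reals all_analysis.
From mathcomp Require Import lra.

Import Order.TTheory GRing.Theory Num.Theory.
Import numFieldNormedType.Exports.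

Local Open Scope ring_scope.

Set Implicit Arguments.
Unset Strict Implicit.

(** For [0 <= s] both factors grow with the argument. Oddness reflects the case of two negative
    arguments to this one, and 0 separates arguments of opposite sign. *)
Lemma ler_signed_powR (R : realType) (r s t : R) : 0 <= r -> s <= t ->
  `|s| `^ r * s <= `|t| `^ r * t.
Proof.
move=> r0 st; have [s0|s0] := leP 0 s.
  have t0 : 0 <= t by exact: le_trans st.
  rewrite !ger0_norm// ler_pM ?powR_ge0//.
  by rewrite ge0_ler_powR// nnegrE.
have [t0|t0] := leP 0 t.
  apply: (@le_trans _ _ 0); last by rewrite mulr_ge0 ?powR_ge0.
  by rewrite mulr_ge0_le0 ?powR_ge0 // ltW.
rewrite -lerN2 -!mulrN !ltr0_norm// ler_pM ?powR_ge0 ?lerN2//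
  ?oppr_ge0 ?(ltW t0)//.
by rewrite ge0_ler_powR// ?nnegrE ?oppr_ge0 ?lerN2// ltW.
Qed.

Lemma continuous_signed_powR (R : realType) (r : R) : 0 <= r ->
  continuous (fun t : R => `|t| `^ r * t).
Proof.
move=> r0 s; have [->|s0] := eqVneq s 0.
  rewrite /continuous_at mulr0; apply: norm_cvg0.
  apply: (@squeeze_cvgr _ _ _ _ (cst 0) (fun t : R => `|t|)).
  - near=> t; rewrite normr_ge0/= normrM ger0_norm ?powR_ge0// ler_piMl//.
    have t1 : `|t| <= 1.
      by near: t; apply: (@cvgr0_norm_le _ _ _ _ _ (@id R)).
    by have := ge0_ler_powR r0 _ _ t1; rewrite powR1 !nnegrE; apply.
  - exact: cvg_cst.
  - by have := @norm_continuous R R 0; rewrite /continuous_at normr0.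
apply: (@cvgM R R (nbhs s) _ (fun t : R => `|t| `^ r) id); last exact: cvg_id.
apply: (@continuous_comp _ _ _ _ (fun a : R => a `^ r)).
  exact: norm_continuous.
apply/differentiable_continuous/derivable1_diffP.
by apply: derivable_powR; rewrite in_itv/= andbT normr_gt0.
Unshelve. all: by end_near. Qed.

(** Outside [S] only the bounds [L] and [U] constrain the solution, so boundary values are imposed
    by letting [L] and [U] agree there. *)
Lemma sub_super_solution (R : realType) (T : eqType) (S : {pred T})
    (F : (T -> R) -> T -> R) (L U : T -> R)
    (F_anti : forall x u v, x \in S -> u x = v x ->
      (forall y, u y <= v y) -> F v x <= F u x)
    (F_cont : forall x (u : T -> R), x \in S ->
      continuous (fun t => F [eta u with x |-> t] x))
    (LU : forall x, L x <= U x)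
    (F_L : forall x, x \in S -> F L x <= 0)
    (F_U : forall x, x \in S -> 0 <= F U x) :
  exists2 u : T -> R, (forall x, L x <= u x <= U x) &
    forall x, x \in S -> F u x = 0.
Proof.
pose A := [set v : T -> R | (forall y, L y <= v y <= U y) /\
  (forall x, x \in S -> 0 <= F v x)]%classic.
have AU : A U by split=> // y; rewrite LU lexx.
pose u x := inf [set v x | v in A]%classic.
have A_lb x : lbound [set v x | v in A]%classic (L x).
  by move=> _ [v [Lv _] <-]; have /andP[] := Lv x.
have A_n0 x : ([set v x | v in A] !=set0)%classic by exists (U x), U.
have u_le v y : A v -> u y <= v y.
  by move=> Av; apply: ge_inf; [exists (L y) | exists v].
have L_le y : L y <= u y by exact: lb_le_inf.
have updE (x : T) : ([eta u with x |-> u x] : T -> R) = u.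
  by apply/funext => y /=; case: eqVneq => [->|].
(* If the residual of [u] were negative at [x], it would stay negative after raising [u x] slightly,
   to the value [v x] of some [v] in [A]. The raised function lies below [v] and agrees with it at
   [x], so [F v x] would be negative too. *)
have F_ge0 x : x \in S -> 0 <= F u x.
  move=> xS; rewrite leNgt; apply/negP => Fu_lt0.
  have := F_cont x u xS (u x); rewrite /continuous_at updE.
  move=> /cvgr_lt/(_ _ Fu_lt0)/nbhs_ballP[e /= e0 He].
  have [_ [v Av <-] vx] : exists2 t, [set v x | v in A]%classic t & t < u x + e.
    by apply: inf_adherent => //; split=> //; exists (L x).
  have ux := u_le v x Av.
  have : F [eta u with x |-> v x] x < 0.
    by apply: He; rewrite /ball/= distrC ger0_norm ?subr_ge0// ltrBlDl.
  rewrite ltNge => /negP; apply; apply: (@le_trans _ _ (F v x)).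
    by case: Av => _; apply.
  apply: F_anti => //=; first by rewrite eqxx.
  by move=> y; case: eqVneq => [->//|_]; exact: u_le.
exists u; first by move=> x; rewrite L_le u_le.
move=> x xS; apply: le_anti; rewrite F_ge0// andbT leNgt; apply/negP => Fu_gt0.
(* Where u x = L x the residual is at most that of L, hence nonpositive;
   elsewhere u x can be lowered to t without leaving A. *)
have [Lu|uL] := ltP (L x) (u x); last first.
  have := lt_le_trans Fu_gt0 (F_anti x L u xS _ L_le).
  rewrite ltNge F_L// => /(_ _)/negP; case=> //.
  by apply: le_anti; rewrite uL L_le.
have := F_cont x u xS (u x); rewrite /continuous_at updE.
move=> /cvgr_gt/(_ _ Fu_gt0)/nbhs_ballP[e /= e0 He].
(* The maximum keeps [t] above the subsolution, and [e / 2] keeps it inside the ball. *)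
pose t := Num.max (L x) (u x - e / 2).
have tu : t < u x by rewrite gt_max Lu/= ltrBlDr ltrDl divr_gt0.
have Ft : 0 < F [eta u with x |-> t] x.
  apply: He; rewrite /ball/= gtr0_norm ?subr_gt0// ltrBlDr -ltrBlDl.
  by rewrite lt_max; apply/orP; right; rewrite ltrD2l ltrN2; lra.
have At : A [eta u with x |-> t].
  split=> [y|y yS]; first rewrite /=; case: (eqVneq y x) => [->|yx].
  - by rewrite le_max lexx/= (le_trans (ltW tu))// u_le.
  - by rewrite L_le u_le.
  - exact: ltW.
  (* At a vertex other than [x], lowering the value at [x] can only raise the residual. *)
  - apply: le_trans (F_ge0 y yS) _; apply: F_anti => //=.
      by rewrite (negbTE yx).
    by move=> z; case: eqVneq => [->|//]; exact: ltW.
by have := u_le _ x At; rewrite /= eqxx leNgt tu.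
Qed.

Lemma powR_superlinear (R : realType) (a b c m r : R) :
  0 < a -> 0 < b -> 0 < c -> 0 <= m -> m < r ->
  exists M0 : R, forall M, M0 <= M -> b * M `^ m + c <= a * M `^ r.
Proof.
move=> a0 b0 c0 m0 mr.
pose k := r - m; have k0 : 0 < k by rewrite subr_gt0.
pose B := (b + c) / a; have B0 : 0 < B by rewrite divr_gt0 ?addr_gt0.
exists (Num.max 1 (B `^ k^-1)) => M; rewrite ge_max => /andP[M1 MB].
have M0 : 0 < M by exact: lt_le_trans M1.
have BM : B <= M `^ k.
  rewrite -[B]powRr1 ?(ltW B0)// -(mulVf (lt0r_neq0 k0)) powRrM.
  by rewrite ge0_ler_powR ?nnegrE ?powR_ge0 ?(ltW k0) ?(ltW M0).
have Mm : 1 <= M `^ m.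
  by rewrite -(powRr0 M) ler_powR.
have -> : r = m + k by rewrite addrC subrK.
rewrite powRD ?(lt0r_neq0 M0) ?implybT//.
apply: (@le_trans _ _ (M `^ m * (b + c))).
  by rewrite mulrDr mulrC lerD2l ler_peMl// ltW.
rewrite mulrCA ler_pM2l ?(lt_le_trans _ Mm)//.
by move: BM; rewrite ler_pdivrMr// mulrC.
Qed.

Lemma le_max_on (R : realType) (T : finType) (S : {set T}) (F : T -> R) x :
  x \in S -> F x <= max_on S F.
Proof.
move=> xS; rewrite /max_on; case: pickP => [x0 x0S|/(_ x)]; last by rewrite xS.
by case: arg_maxP => // i _; apply.
Qed.

Lemma ge_min_on (R : realType) (T : finType) (S : {set T}) (F : T -> R) x :
  x \in S -> min_on S F <= F x.
Proof.
move=> xS; rewrite /min_on; case: pickP => [x0 x0S|/(_ x)]; last by rewrite xS.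
by case: arg_minP => // i _; apply.
Qed.

Section PLaplacian.
Context {R : realType} {T : finType} (w : T -> T -> R) (p : T -> R).
Context (w_ge0 : forall x y, 0 <= w x y) (p_ge2 : forall x, 2 <= p x).

Lemma p_laplacian_mono (u v : T -> R) x : u x = v x ->
  (forall y, u y <= v y) -> p_laplacian w p u x <= p_laplacian w p v x.
Proof.
move=> uvx uv; apply: ler_sum => y _; apply: ler_wpM2r; first exact: w_ge0.
by rewrite ler_signed_powR ?subr_ge0// uvx lerB.
Qed.

Lemma p_laplacian_le0 (u : T -> R) x : (forall y, u y <= u x) ->
  p_laplacian w p u x <= 0.
Proof.
move=> ux; apply: sumr_le0 => y _; apply: mulr_le0_ge0; last exact: w_ge0.
by rewrite mulr_ge0_le0 ?powR_ge0// subr_le0.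
Qed.

Lemma p_laplacian_cst (c : R) x : p_laplacian w p (fun=> c) x = 0.
Proof. by apply: big1 => y _; rewrite subrr mulr0 mul0r. Qed.

Lemma continuous_p_laplacian (u : T -> R) x :
  continuous (fun t : R => p_laplacian w p [eta u with x |-> t] x).
Proof.
apply: (@continuous_big _ _ +%R) => [|y _]; first exact: add_continuous.
move=> t; pose D (s : R) : R := [eta u with x |-> s] y - [eta u with x |-> s] x.
apply: (@cvgM R R (nbhs t) _ (fun s => `|D s| `^ (p x - 2) * D s)
  (fun=> w x y)); last exact: cvg_cst.
apply: (@continuous_comp _ _ _ D (fun s : R => `|s| `^ (p x - 2) * s)).
  (* For [y = x] both values move together and the difference is [s - s]; otherwise only the second
     one moves. *)
  rewrite /D /= eqxx; case: eqVneq => _.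
    by apply: (@continuousB R R^o); exact: cvg_id.
  by apply: (@continuousB R R^o); [exact: cvg_cst|exact: cvg_id].
by apply: continuous_signed_powR; rewrite subr_ge0.
Qed.

End PLaplacian.

Theorem theorem9 (R : realType) (T : finType) (S dS : {set T})
    (V : {set {set T}}) (w : T -> T -> R)
    (graph : weighted_graph_with_boundary S dS V w)
    (q : T -> R) (q_gt0 : forall x, x \in S -> 0 < q x)
    (p : T -> R) (p_ge2 : forall x, 2 <= p x)
    (f : T -> R -> R) (f_cont : forall x, x \in S -> continuous (f x))
    (m1 m2 phi1 phi2 psi1 psi2 : T -> R)
    (m1_ge2 : forall x, x \in S -> 2 <= m1 x)
    (m2_ge2 : forall x, x \in S -> 2 <= m2 x)
    (phi1_gt0 : forall x, x \in S -> 0 < phi1 x)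
    (phi2_gt0 : forall x, x \in S -> 0 < phi2 x)
    (psi1_gt0 : forall x, x \in S -> 0 < psi1 x)
    (psi2_gt0 : forall x, x \in S -> 0 < psi2 x)
    (m2_lt_p : max_on S m2 < min_on S p)
    (f_growth : forall x (t : R), x \in S -> 0 <= t ->
       psi1 x + phi1 x * t `^ (m1 x - 1) <= f x t /\
       f x t <= phi2 x * t `^ (m2 x - 1) + psi2 x) :
  forall lambda : R, 0 < lambda ->
    exists u : T -> R,
      positive_solution S dS w p q (fun x t => lambda * f x t) u.
Proof.
move=> lambda lambda0.
have w_ge0 := weight_ge0 graph.
pose F u x := - p_laplacian w p u x + q x * `|u x| `^ (p x - 2) * u x -
  lambda * f x (u x).
have F_anti x u v : x \in S -> u x = v x -> (forall y, u y <= v y) ->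
    F v x <= F u x.
  by move=> xS uvx uv; rewrite /F uvx !lerD2r lerN2 p_laplacian_mono.
have F_cont x (u : T -> R) : x \in S ->
    continuous (fun t => F [eta u with x |-> t] x).
  move=> xS t; rewrite /F /= eqxx.
  pose Q (s : R) := `|s| `^ (p x - 2) * s.
  apply: (@cvgB _ R _ (nbhs t) _
    (fun s => - p_laplacian w p [eta u with x |-> s] x +
              q x * `|s| `^ (p x - 2) * s)
    (fun s => lambda * f x s)).
    apply: (@cvgD _ R _ (nbhs t) _
      (fun s => - p_laplacian w p [eta u with x |-> s] x)).
      by apply: (@cvgN _ R); exact: continuous_p_laplacian.
    under eq_cvg do rewrite -mulrA; rewrite -mulrA.
    apply: (@cvgM R R (nbhs t) _ (fun=> q x) Q); first exact: cvg_cst.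
    by apply: continuous_signed_powR; rewrite subr_ge0.
  by apply: (@cvgM R R (nbhs t) _ (fun=> lambda));
    [exact: cvg_cst|exact: f_cont].
have F_0 x : x \in S -> F (fun=> 0) x < 0.
  move=> xS; rewrite /F p_laplacian_cst mulr0 oppr0 !add0r oppr_lt0 mulr_gt0//.
  apply: lt_le_trans (psi1_gt0 _ xS) _.
  have [+ _] := f_growth x 0 xS (lexx _); apply: le_trans.
  by rewrite lerDl mulr_ge0 ?powR_ge0// ltW// phi1_gt0.
(* Each vertex has its own threshold, with 0 as a dummy outside [S]; finiteness of [T] collects them
   into one function. *)
have /fin_all_exists[M0 HM0] (x : T) : exists M0 : R,
    x \in S -> forall M, M0 <= M ->
    lambda * phi2 x * M `^ (m2 x - 1) + lambda * psi2 x <= q x * M `^ (p x - 1).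
  have [xS|_] := boolP (x \in S); last by exists 0.
  have m2p : m2 x < p x.
    rewrite (le_lt_trans (le_max_on m2 xS))//.
    by rewrite (lt_le_trans m2_lt_p) ?ge_min_on.
  have [||||M0 HM0] := @powR_superlinear R (q x) (lambda * phi2 x)
    (lambda * psi2 x) (m2 x - 1) (p x - 1) (q_gt0 _ xS).
  - by rewrite mulr_gt0 ?phi2_gt0.
  - by rewrite mulr_gt0 ?psi2_gt0.
  - by have := m2_ge2 x xS; lra.
  - by rewrite ltrD2r.
  - by exists M0.
(* The sum dominates every threshold, and the 1 makes [M] positive. *)
pose M := 1 + \sum_x `|M0 x|.
have M0M x : M0 x <= M.
  rewrite /M (bigD1 x)//= addrCA (le_trans (ler_norm _))// lerDl.
  by rewrite addr_ge0// sumr_ge0.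
have M_gt0 : 0 < M by rewrite ltr_pwDl// sumr_ge0.
pose U x := if x \in S then M else 0.
have U_ge0 x : 0 <= U x by rewrite /U; case: ifP => // _; exact: ltW.
have F_U x : x \in S -> 0 <= F U x.
  move=> xS; rewrite /F.
  have Lap : p_laplacian w p U x <= 0.
    apply: p_laplacian_le0 => // y; rewrite /U xS.
    by case: ifP => // _; exact: ltW.
  have UxM : U x = M by rewrite /U xS.
  have [_ fle] := f_growth x M xS (ltW M_gt0).
  rewrite UxM gtr0_norm// -mulrA [_ * M]mulrC.
  rewrite (_ : p x - 2 = (p x - 1) - 1); last by lra.
  rewrite mulr_powRB1 ?(ltW M_gt0)//; last by have := p_ge2 x; lra.
  rewrite subr_ge0; apply: (@le_trans _ _ (q x * M `^ (p x - 1))).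
    apply: le_trans (HM0 x xS M (M0M x)).
    by rewrite -mulrA -mulrDr ler_pM2l.
  by rewrite lerDr oppr_ge0.
have [] := @sub_super_solution R T S F (fun=> 0) U F_anti F_cont U_ge0.
- by move=> x xS; exact/ltW/F_0.
- exact: F_U.
move=> u u_bd Fu; exists u; split; first split.
- by move=> x xS; apply/eqP; rewrite -subr_eq0; apply/eqP/Fu.
(* On the boundary both barriers are 0. *)
- move=> x xdS; apply: le_anti; have := u_bd x; rewrite /U.
  rewrite (disjointFl (interior_boundary_disjoint graph))//.
  by rewrite andbC.
- move=> x xS; have /andP[ux0 _] := u_bd x; rewrite lt_neqAle ux0 andbT.
  apply/eqP => ux.
  have := F_anti x _ u xS ux (fun y => proj1 (andP (u_bd y))).
  by rewrite Fu// leNgt F_0.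
Qed.
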